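(* Let $n > d \geq 1$ be integers and put $$c = (n-2d)\sqrt{\frac{n-1}{d(n-d)}}.$$ Suppose $|c| \leq 1$. If there is a real or complex ETF of size $d \times n$, then there is a complex ETF of size $n \times 2n$. Specifically, the following hold for $\epsilon = \pm 1$ (either choice) and $\beta = -c + \epsilon i \sqrt{1-c^2}$. (a) If $S$ is the signature matrix of a real or complex ETF of size $d \times n$, then $$\Sigma = \begin{bmatrix} S & S + \beta I \\ S + \overline{\beta} I & -S \end{bmatrix}$$ is the signature matrix of a complex ETF of size $n \times 2n$. (b) If $F$ is a (real or complex) ETF of size $d \times n$ with signature matrix $S$ and Naimark complement $G$, then there exist constants $a, b > 0$ and $w, z \in \mathbb{C}$ such that $$\Phi = \begin{bmatrix} aF & wF \\ bG & zG \end{bmatrix}$$ is an ETF of size $n \times 2n$. Namely, with $$\mu = \sqrt{\frac{n-d}{d(n-1)}}, \qquad \nu = \sqrt{\frac{d}{(n-d)(n-1)}}, \qquad \lambda = \frac{1}{\sqrt{2n-1}},$$ one can take $$a = \sqrt{\frac{\nu+\lambda}{\mu+\nu}}, \quad b = \sqrt{\frac{\mu-\lambda}{\mu+\nu}}, \quad w = \frac{\lambda(n-d+\mu\beta d)}{a\mu n}, \quad z = \frac{-\lambda\big(d - \nu\beta(n-d)\big)}{b\nu n},$$ and then $\Phi$ has signature matrix equal to the matrix $\Sigma$ in part (a).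
   Context: For $n > d \geq 1$, an equiangular tight frame (ETF) of size $d \times n$ is a matrix $F = [f_1 \cdots f_n] \in \mathbb{C}^{d \times n}$ with unit-norm columns such that (i) $|f_i^* f_j| = \mu$ for all $i \neq j$, where $\mu = \sqrt{\frac{n-d}{d(n-1)}}$, and (ii) $FF^* = \frac{n}{d} I$. It is a real ETF if its entries are real; a complex ETF is one with entries in $\mathbb{C}$ (possibly real). The signature matrix of a $d \times n$ ETF $F$ is the $n \times n$ matrix $S = \frac{1}{\mu}(F^*F - I)$ with $\mu = \sqrt{\frac{n-d}{d(n-1)}}$; for an ETF $\Phi$ of size $n \times 2n$ the corresponding value of $\mu$ is $\frac{1}{\sqrt{2n-1}}$. If $F$ is a $d \times n$ ETF with signature matrix $S$, a Naimark complement of $F$ is any $(n-d) \times n$ ETF $G$ whose signature matrix is $-S$; equivalently $G^*G = I - \nu S$ with $\nu = \sqrt{\frac{d}{(n-d)(n-1)}}$. *)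

(* Defs.v *)
From mathcomp Require Export all_boot all_order all_algebra.
From mathcomp Require Export reals complex.

Set Implicit Arguments.
Unset Strict Implicit.
Unset Printing Implicit Defensive.

Import Order.TTheory GRing.Theory Num.Theory.

Local Open Scope ring_scope.
Local Open Scope sesquilinear_scope.
Local Open Scope complex_scope.

Definition welch (R : realType) (d n : nat) : R :=
  Num.sqrt ((n%:R - d%:R) / (d%:R * (n%:R - 1))).

(* A real ETF is one all of whose entries are real, so [etf] covers both the
   real and the complex case. *)
Definition etf (R : realType) (d n : nat) (F : 'M[R[i]]_(d, n)) : Prop :=
  [/\ (1 <= d < n)%N,
      forall j, sqrtC (\sum_k `|F k j| ^+ 2) = 1,
      forall i j, i != j -> `|(F^t* *m F) i j| = (welch R d n)%:C
    & F *m F^t* = (n%:R / d%:R)%:M].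

Definition signature_mx (R : realType) (d n : nat) (F : 'M[R[i]]_(d, n)) :
    'M[R[i]]_n :=
  ((welch R d n)%:C)^-1 *: (F^t* *m F - 1%:M).

Definition etf_signature (R : realType) (d n : nat) (S : 'M[R[i]]_n) : Prop :=
  exists2 F : 'M[R[i]]_(d, n), etf F & S = signature_mx F.

Definition naimark_complement (R : realType) (d n : nat)
    (F : 'M[R[i]]_(d, n)) (G : 'M[R[i]]_(n - d, n)) : Prop :=
  etf G /\ signature_mx G = - signature_mx F.

Definition cparam (R : realType) (d n : nat) : R :=
  (n%:R - 2 * d%:R) * Num.sqrt ((n%:R - 1) / (d%:R * (n%:R - d%:R))).

Definition doubled_signature (R : realType) (n : nat) (S : 'M[R[i]]_n)
    (beta : R[i]) : 'M[R[i]]_(n + n) :=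
  block_mx S (S + beta%:M) (S + (beta^*)%:M) (- S).

(* The block matrix has d + (n - d) rows; the cast identifies this with n. *)
Definition doubled_frame (R : realType) (d n : nat) (le_dn : (d <= n)%N)
    (F : 'M[R[i]]_(d, n)) (G : 'M[R[i]]_(n - d, n))
    (a b : R) (w z : R[i]) : 'M[R[i]]_(n, n + n) :=
  castmx (subnKC le_dn, erefl (n + n)%N)
    (block_mx (a%:C *: F) (w *: F) (b%:C *: G) (z *: G)).

(* Main.v *)
Require Import Defs.
From mathcomp Require Import ring lra.

(** Let F be an ETF of size d x n with signature matrix S, and G a Naimark
    complement.  With mu and nu the Welch bounds of F and G, the Gram matrices
    are F^* F = I + mu S and G^* G = I - nu S.  A block of the Gram matrix of
    Phi = [aF, wF; bG, zG] is therefore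
      x I + y S,  where x = p + q and y = p mu - q nu,
    p being a product of two weights of F and q one of two weights of G.
    Asking for I + lambda Sigma, block by block, amounts to linear equations in
    these products, solved by
      |a|^2 = (nu + lambda)/(mu + nu),     |b|^2 = (mu - lambda)/(mu + nu),
      |w|^2 = (nu - lambda)/(mu + nu),     |z|^2 = (mu + lambda)/(mu + nu),
      a w = lambda (1 + nu beta)/(mu + nu),
      b z = - lambda (1 - mu beta)/(mu + nu).
    The values of |a|, |b|, a w and b z may be imposed; those of |w| and |z|
    then have to agree with them.  This is where the choice of beta matters:
    since mu nu = 1/(n - 1), the parameter is c = 1/nu - 1/mu, and
    lambda^2 = mu nu/(2 + mu nu); with |beta| = 1 and Re beta = - c this gives
    |1 + nu beta|^2 = (nu/lambda)^2 - 1 and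
    |1 - mu beta|^2 = (mu/lambda)^2 - 1, exactly the compatibility needed
    ([doubled_w_norm], [doubled_z_norm]).  The Gram matrix follows in
    [doubled_gram].

    Tightness of Phi ([doubled_tight]) uses that F and G have orthogonal row
    spaces, together with (|a|^2 + |w|^2) n/d = (|b|^2 + |z|^2) n/(n - d) = 2.
    Sigma has zero diagonal and unimodular entries elsewhere because S does and
    |beta| = 1, so Phi is equiangular with unit columns ([seidel_double],
    [etf_of_gram]).

    The condition |c| <= 1 serves twice: it makes |beta| = 1 possible, and it
    forces lambda < mu, so that b is a positive real ([welch_double_lt]).

    Part (a) and the existence claim follow from this construction once every
    ETF is known to have a Naimark complement: complete the orthonormal rows of
    sqrt(d/n) F to a unitary matrix and rescale the new rows
    ([exists_naimark]). *)

Set Implicit Arguments.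
Unset Strict Implicit.
Unset Printing Implicit Defensive.

Import Order.TTheory GRing.Theory Num.Theory.
Local Open Scope ring_scope.
Local Open Scope sesquilinear_scope.

(** * Adjoints and orthonormal completion *)

Lemma adjmxM (C : numClosedFieldType) (m n p : nat)
    (A : 'M[C]_(m, n)) (B : 'M[C]_(n, p)) :
  (A *m B)^t* = B^t* *m A^t*.
Proof. by rewrite trmx_mul map_mxM. Qed.

Lemma adjmxZ (C : numClosedFieldType) (m n : nat) (a : C) (A : 'M[C]_(m, n)) :
  (a *: A)^t* = a^* *: A^t*.
Proof. by rewrite linearZ /= map_mxZ. Qed.

Lemma gram_diag (C : numClosedFieldType) (m n : nat) (A : 'M[C]_(m, n)) j :
  (A^t* *m A) j j = \sum_k `|A k j| ^+ 2.
Proof. by rewrite mxE; apply: eq_bigr => k _; rewrite !mxE normCKC. Qed.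

(** The rows of W are an orthonormal basis of the orthogonal complement of the
    row space of V.  Stacking V on W gives a square matrix with orthonormal
    rows, whose columns are then orthonormal too: this is the resolution of
    the identity in the conclusion. *)
Lemma orthonormal_complement (C : numClosedFieldType) (d n : nat)
    (V : 'M[C]_(d, n)) :
  V \is unitarymx ->
  exists2 W : 'M[C]_(n - d, n),
    W \is unitarymx & V^t* *m V + W^t* *m W = 1%:M.
Proof.
move=> uV.
have rkV := mxrank_unitary uV.
have le_dn : (d <= n)%N by rewrite -rkV rank_leq_col.
have rkK : \rank (kermx (V^t*)) = (n - d)%N.
  by rewrite mxrank_ker mxrank_map mxrank_tr rkV.
pose W0 := schmidt (row_base (kermx (V^t*))).
have uW0 : W0 \is unitarymx by rewrite schmidt_unitarymx ?rank_leq_col.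
have W0V : W0 *m V^t* = 0.
  apply/sub_kermxP.
  by rewrite (eqmx_schmidt_free (row_base_free _)) eq_row_base.
move: W0 uW0 W0V; rewrite rkK => W uW WV.
exists W => //.
have uVW : col_mx V W \is unitarymx.
  apply/unitarymxP; rewrite tr_col_mx map_row_mx mul_col_row.
  rewrite (unitarymxP uV) (unitarymxP uW) WV.
  have -> : V *m W^t* = 0.
    by rewrite -[LHS]trmxCK adjmxM trmxCK WV trmx0 map_mx0.
  by rewrite -scalar_mx_block.
have := mulmxKtV 1%:M uVW (subnKC le_dn).
by rewrite mul1mx tr_col_mx map_row_mx mul_row_col.
Qed.

(** * Welch bounds of a frame and of its complement *)

Lemma frame_dims_gt0 (R : numDomainType) (d n : nat) : (0 < d < n)%N ->
  [/\ 0 < d%:R :> R, d%:R < n%:R :> R & 1 < n%:R :> R].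
Proof.
case/andP=> d0 ltdn; rewrite ltr0n d0 ltr_nat ltdn ltr1n.
by rewrite (leq_ltn_trans d0).
Qed.

Lemma compl_dims (d n : nat) : (0 < d < n)%N -> (0 < n - d < n)%N.
Proof.
case/andP=> d0 ltdn.
by rewrite subn_gt0 ltdn ltn_subrL d0 (leq_trans _ ltdn).
Qed.

Lemma compl_natr (R : pzRingType) (d n : nat) : (0 < d < n)%N ->
  (n - d)%N%:R = n%:R - d%:R :> R.
Proof. by case/andP=> _ ltdn; rewrite natrB // ltnW. Qed.

Section Welch.
Variables (R : realType) (d n : nat).
Hypothesis dn : (0 < d < n)%N.

Lemma welch_gt0 : 0 < welch R d n.
Proof.
have [d0 ltdn n1] := frame_dims_gt0 R dn.
by rewrite /welch sqrtr_gt0 divr_gt0 ?mulr_gt0 ?subr_gt0.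
Qed.

Lemma sqr_welch : welch R d n ^+ 2 = (n%:R - d%:R) / (d%:R * (n%:R - 1)).
Proof.
have [d0 ltdn n1] := frame_dims_gt0 R dn.
by rewrite /welch sqr_sqrtr // divr_ge0 ?mulr_ge0 ?subr_ge0 // ltW.
Qed.

End Welch.

Section WelchComplement.
Variables (R : realType) (d n : nat).
Hypothesis dn : (0 < d < n)%N.
Let mu := welch R d n.
Let nu := welch R (n - d) n.

Lemma welch_compl :
  nu = Num.sqrt (d%:R / ((n%:R - d%:R) * (n%:R - 1))).
Proof. by rewrite /nu /welch compl_natr // opprB addrC subrK. Qed.

(** Both sides are the square root of d (n - d)/(n - 1).  As mu and nu are
    thus proportional to n - d and d, the dimensions can be eliminated in
    favour of the two Welch bounds ([welch_sum], [welch_sum_compl],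
    [welch_prod]), which leaves no square roots in the later algebra. *)
Lemma welch_balance : mu * d%:R = nu * (n%:R - d%:R).
Proof.
have [d0 ltdn n1] := frame_dims_gt0 R dn.
have cd := compl_dims dn.
apply/eqP; rewrite -(@eqrXn2 _ 2) //; last first.
- by rewrite mulr_ge0 ?subr_ge0 ?(ltW ltdn) ?(ltW (welch_gt0 R cd)).
- by rewrite mulr_ge0 ?(ltW d0) ?(ltW (welch_gt0 R dn)).
rewrite !exprMn /mu /nu !sqr_welch // compl_natr //; apply/eqP.
by field; rewrite !lt0r_neq0 // subr_gt0.
Qed.

Lemma welch_sum : (mu + nu) * d%:R = nu * n%:R.
Proof. by rewrite mulrDl welch_balance -mulrDr subrK. Qed.

Lemma welch_sum_compl : (mu + nu) * (n%:R - d%:R) = mu * n%:R.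
Proof. by rewrite mulrDl -welch_balance -mulrDr subrK. Qed.

Lemma welch_prod : mu * nu * (n%:R - 1) = 1.
Proof.
have [d0 ltdn n1] := frame_dims_gt0 R dn.
have nd0 : 0 < n%:R - d%:R :> R by rewrite subr_gt0.
apply: (mulIf (lt0r_neq0 nd0)); rewrite mul1r.
have -> : mu * nu * (n%:R - 1) * (n%:R - d%:R)
    = mu * (nu * (n%:R - d%:R)) * (n%:R - 1) by ring.
rewrite -welch_balance mulrA -expr2 sqr_welch //.
by field; rewrite !lt0r_neq0 // subr_gt0.
Qed.

(** In this form c = 1/nu - 1/mu, the form in which c enters the norms of
    1 + nu beta and 1 - mu beta. *)
Lemma cparamE : cparam R d n = (mu - nu) / (mu * nu).
Proof.
have [d0 ltdn n1] := frame_dims_gt0 R dn.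
have nd0 : 0 < n%:R - d%:R :> R by rewrite subr_gt0.
have n10 : 0 < n%:R - 1 :> R by rewrite subr_gt0.
have mu0 : 0 < mu := welch_gt0 R dn.
have nu0 : 0 < nu := welch_gt0 R (compl_dims dn).
have n0 : 0 < n%:R :> R by apply: lt_trans n1.
rewrite /cparam; have -> : mu - nu = (mu + nu) * (n%:R - 2 * d%:R) / n%:R.
  apply: (mulIf (lt0r_neq0 n0)); rewrite divfK ?lt0r_neq0 //.
  rewrite mulrBl -welch_sum -welch_sum_compl; ring.
have -> : Num.sqrt ((n%:R - 1) / (d%:R * (n%:R - d%:R)))
    = (mu + nu) / (mu * nu * n%:R) :> R.
  apply/eqP; rewrite -(@eqrXn2 _ 2) ?sqrtr_ge0 //; last first.
    by rewrite divr_ge0 ?mulr_ge0 ?addr_ge0 // ltW.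
  rewrite sqr_sqrtr ?divr_ge0 ?mulr_ge0 ?ltW //; apply/eqP.
  have -> : n%:R - 1 = (mu * nu)^-1.
    apply: (mulfI (lt0r_neq0 (mulr_gt0 mu0 nu0))).
    by rewrite welch_prod divff ?lt0r_neq0 ?mulr_gt0.
  have mn0 : 0 < mu + nu by rewrite addr_gt0.
  have -> : d%:R = nu * n%:R / (mu + nu).
    by rewrite -welch_sum mulrC mulKf ?lt0r_neq0.
  have -> : n%:R - nu * n%:R / (mu + nu) = mu * n%:R / (mu + nu).
    by field; rewrite lt0r_neq0.
  by field; rewrite !lt0r_neq0.
by field; rewrite !lt0r_neq0.
Qed.

End WelchComplement.

(** * Gram matrix and tightness of the doubled frame *)

(** Everything is expressed through mu, nu and lambda.  The weights w and z are
    those of the theorem with d and n - d replaced by nu n/(mu + nu) and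
    mu n/(mu + nu); [be_trace] says that the real part of beta is
    - (mu - nu)/(mu nu). *)
Section Doubling.
Variables (C : numClosedFieldType) (mu nu lam a b be : C).
Hypotheses (mu_gt0 : 0 < mu) (nu_gt0 : 0 < nu) (lam_gt0 : 0 < lam).
Hypotheses (a_gt0 : 0 < a) (b_gt0 : 0 < b).
Hypothesis lamE : lam ^+ 2 * (2 + mu * nu) = mu * nu.
Hypothesis aE : a ^+ 2 * (mu + nu) = nu + lam.
Hypothesis bE : b ^+ 2 * (mu + nu) = mu - lam.
Hypothesis be_norm : be * be^* = 1.
Hypothesis be_trace : (be + be^*) * (mu * nu) = - 2 * (mu - nu).

Let w := lam * (1 + nu * be) / ((mu + nu) * a).
Let z := - lam * (1 - mu * be) / ((mu + nu) * b).

Let conj_reals :=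
  (geC0_conj (ltW mu_gt0), geC0_conj (ltW nu_gt0), geC0_conj (ltW lam_gt0),
   geC0_conj (ltW a_gt0), geC0_conj (ltW b_gt0)).

(** As |beta| = 1, |1 + nu beta|^2 = 1 + nu^2 + 2 nu Re beta, which is
    (nu/lambda)^2 - 1 by the values of Re beta and lambda.  Dividing
    |a w|^2 (mu + nu)^2 = nu^2 - lambda^2 by a^2 (mu + nu) = nu + lambda leaves
    the claim. *)
Lemma doubled_w_norm : w * w^* * (mu + nu) = nu - lam.
Proof.
have mn0 : mu + nu != 0 by rewrite lt0r_neq0 ?addr_gt0.
have nl0 : nu + lam != 0 by rewrite lt0r_neq0 ?addr_gt0.
have a0 := lt0r_neq0 a_gt0.
have -> : w^* = lam * (1 + nu * be^*) / ((mu + nu) * a).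
  rewrite /w !(rmorphM, fmorphV, rmorphD, rmorph1) /=.
  by rewrite !conj_reals.
have -> : w * (lam * (1 + nu * be^*) / ((mu + nu) * a)) * (mu + nu)
   = lam ^+ 2 * (1 + nu ^+ 2 * (be * be^*) + nu * (be + be^*))
     / (a ^+ 2 * (mu + nu)).
  by rewrite /w; field; rewrite mn0 a0.
rewrite aE be_norm; apply: (mulIf nl0); rewrite divfK //.
apply: (mulIf (lt0r_neq0 mu_gt0)).
have -> : lam ^+ 2 * (1 + nu ^+ 2 * 1 + nu * (be + be^*)) * mu
  = lam ^+ 2 * (mu + nu ^+ 2 * mu + (be + be^*) * (mu * nu)) by ring.
rewrite be_trace.
have -> : lam ^+ 2 * (mu + nu ^+ 2 * mu + - 2 * (mu - nu))
  = lam ^+ 2 * (2 + mu * nu) * nu - lam ^+ 2 * mu by ring.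
by rewrite lamE; ring.
Qed.

(** The same computation as for [doubled_w_norm], under the symmetry that
    exchanges mu with nu and reverses the signs of lambda and beta. *)
Lemma doubled_z_norm : z * z^* * (mu + nu) = mu + lam.
Proof.
have mn0 : mu + nu != 0 by rewrite lt0r_neq0 ?addr_gt0.
have b0 := lt0r_neq0 b_gt0.
have ml0 : mu - lam != 0 by rewrite -bE mulf_neq0 ?expf_neq0.
have -> : z^* = - lam * (1 - mu * be^*) / ((mu + nu) * b).
  rewrite /z !(rmorphM, fmorphV, rmorphD, rmorphN, rmorph1) /=.
  by rewrite !conj_reals.
have -> : z * (- lam * (1 - mu * be^*) / ((mu + nu) * b)) * (mu + nu)
   = lam ^+ 2 * (1 + mu ^+ 2 * (be * be^*) - mu * (be + be^*))
     / (b ^+ 2 * (mu + nu)).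
  by rewrite /z; field; rewrite mn0 b0.
rewrite bE be_norm; apply: (mulIf ml0); rewrite divfK //.
apply: (mulIf (lt0r_neq0 nu_gt0)).
have -> : lam ^+ 2 * (1 + mu ^+ 2 * 1 - mu * (be + be^*)) * nu
  = lam ^+ 2 * (nu + mu ^+ 2 * nu - (be + be^*) * (mu * nu)) by ring.
rewrite be_trace.
have -> : lam ^+ 2 * (nu + mu ^+ 2 * nu - - 2 * (mu - nu))
  = lam ^+ 2 * (2 + mu * nu) * mu - lam ^+ 2 * nu by ring.
by rewrite lamE; ring.
Qed.

Variables (p q n : nat) (F : 'M[C]_(p, n)) (G : 'M[C]_(q, n)) (S : 'M[C]_n).
Hypothesis gramF : F^t* *m F = 1%:M + mu *: S.
Hypothesis gramG : G^t* *m G = 1%:M - nu *: S.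

(** Each block of Phi^* Phi is of this form; it stays in the span of I and S,
    so that only scalar identities remain. *)
Lemma gram_combine (x x' y y' : C) :
  (x *: F)^t* *m (x' *: F) + (y *: G)^t* *m (y' *: G)
  = (x^* * x' + y^* * y')%:M + (x^* * x' * mu - y^* * y' * nu) *: S.
Proof.
rewrite !adjmxZ -!scalemxAl -!scalemxAr !scalerA gramF gramG.
apply/matrixP=> i j; rewrite !mxE -[(_ + _) *+ _]mulr_natr.
move: (x^* * x') (y^* * y') (S i j) (i == j)%:R => u v s k; ring.
Qed.

Lemma doubled_gram :
  let Phi := block_mx (a *: F) (w *: F) (b *: G) (z *: G) in
  Phi^t* *m Phi
  = 1%:M + lam *: block_mx S (S + be%:M) (S + (be^*)%:M) (- S).
Proof.
move=> Phi.
have mn0 : mu + nu != 0 by rewrite lt0r_neq0 ?addr_gt0.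
have a0 := lt0r_neq0 a_gt0; have b0 := lt0r_neq0 b_gt0.
have ca : a^* = a by rewrite geC0_conj ?ltW.
have cb : b^* = b by rewrite geC0_conj ?ltW.
have a2 : a * a = (nu + lam) / (mu + nu) by rewrite -aE expr2 mulfK.
have b2 : b * b = (mu - lam) / (mu + nu) by rewrite -bE expr2 mulfK.
have w2 : w^* * w = (nu - lam) / (mu + nu).
  by rewrite -doubled_w_norm mulfK // mulrC.
have z2 : z^* * z = (mu + lam) / (mu + nu).
  by rewrite -doubled_z_norm mulfK // mulrC.
have aw : a * w = lam * (1 + nu * be) / (mu + nu).
  by rewrite /w; field; rewrite mn0 a0.
have bz : b * z = - lam * (1 - mu * be) / (mu + nu).
  by rewrite /z; field; rewrite mn0 b0.
have wa : w^* * a = lam * (1 + nu * be^*) / (mu + nu).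
  have -> : w^* * a = (a * w)^* by rewrite [RHS]rmorphM /= ca mulrC.
  rewrite aw !(rmorphM, fmorphV, rmorphD, rmorph1) /=.
  by rewrite !conj_reals.
have zb : z^* * b = - lam * (1 - mu * be^*) / (mu + nu).
  have -> : z^* * b = (b * z)^* by rewrite [RHS]rmorphM /= cb mulrC.
  rewrite bz !(rmorphM, fmorphV, rmorphD, rmorphN, rmorph1) /=.
  by rewrite !conj_reals.
rewrite /Phi tr_block_mx map_block_mx mulmx_block !gram_combine.
rewrite ca cb a2 b2 w2 z2 aw bz wa zb.
rewrite scalar_mx_block scale_block_mx add_block_mx.
congr block_mx.
- by congr (_%:M + _ *: _); field.
- rewrite add0r scalerDr scale_scalar_mx addrC.
  by congr (_ *: _ + _%:M); field.
- rewrite add0r scalerDr scale_scalar_mx addrC.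
  by congr (_ *: _ + _%:M); field.
- rewrite scalerN -scaleNr.
  by congr (_%:M + _ *: _); field.
Qed.

Variables (f g : C).
Hypothesis tightF : F *m F^t* = f%:M.
Hypothesis tightG : G *m G^t* = g%:M.
Hypothesis fE : nu * f = mu + nu.
Hypothesis gE : mu * g = mu + nu.

(** Eliminating S gives nu F^*F + mu G^*G = (mu + nu) I.  Multiplying by F on
    the left, the first term already is (mu + nu) F by tightness, hence
    F G^* G = 0; multiplying by G^* on the right and using tightness of G
    removes the last factor. *)
Lemma synthesis_orthogonal : F *m G^t* = 0.
Proof.
have mn0 : mu + nu != 0 by rewrite lt0r_neq0 ?addr_gt0.
have mu0 := lt0r_neq0 mu_gt0.
have g0 : g != 0 by apply: contraNneq mn0 => g0; rewrite -gE g0 mulr0.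
have resol : nu *: (F^t* *m F) + mu *: (G^t* *m G) = (mu + nu)%:M.
  rewrite gramF gramG; apply/matrixP=> i j.
  by rewrite !mxE -[(_ + _) *+ _]mulr_natr; ring.
have FGG : F *m G^t* *m G = 0.
  have := congr1 (mulmx F) resol.
  rewrite mulmxDr -!scalemxAr mulmxA tightF mul_scalar_mx mul_mx_scalar.
  rewrite scalerA fE -[RHS]addr0 => /addrI /eqP.
  by rewrite scaler_eq0 (negPf mu0) mulmxA => /eqP.
apply/eqP; have := congr1 (mulmx^~ (G^t*)) FGG.
rewrite /= mul0mx -mulmxA tightG mul_mx_scalar => /eqP.
by rewrite scaler_eq0 (negPf g0).
Qed.

Lemma doubled_tight :
  let Phi := block_mx (a *: F) (w *: F) (b *: G) (z *: G) in
  Phi *m Phi^t* = 2%:M.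
Proof.
move=> Phi.
have mn0 : mu + nu != 0 by rewrite lt0r_neq0 ?addr_gt0.
have mu0 := lt0r_neq0 mu_gt0; have nu0 := lt0r_neq0 nu_gt0.
have ca : a^* = a by rewrite geC0_conj ?ltW.
have cb : b^* = b by rewrite geC0_conj ?ltW.
have FG := synthesis_orthogonal.
have GF : G *m F^t* = 0.
  by rewrite -[LHS]trmxCK adjmxM trmxCK FG trmx0 map_mx0.
have ff : f = (mu + nu) / nu by rewrite -fE mulrC mulKf.
have gg : g = (mu + nu) / mu by rewrite -gE mulrC mulKf.
rewrite /Phi tr_block_mx map_block_mx mulmx_block !adjmxZ.
rewrite -!scalemxAl -!scalemxAr tightF tightG FG GF !scaler0 !addr0.
rewrite ca cb scalar_mx_block !scale_scalar_mx -!raddfD /=.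
congr block_mx; congr (_%:M).
  have -> : a * (a * f) + w * (w^* * f)
    = (a ^+ 2 * (mu + nu) + w * w^* * (mu + nu)) * f / (mu + nu) by field.
  by rewrite aE doubled_w_norm ff; field; rewrite nu0 mn0.
have -> : b * (b * g) + z * (z^* * g)
  = (b ^+ 2 * (mu + nu) + z * z^* * (mu + nu)) * g / (mu + nu) by field.
by rewrite bE doubled_z_norm gg; field; rewrite mu0 mn0.
Qed.

End Doubling.

(** * Signature matrices *)

(** Together with a Gram matrix I + mu S, this is what the unit norms and the
    equiangularity of an ETF say about its signature matrix S. *)
Definition seidel (C : numClosedFieldType) (n : nat) (S : 'M[C]_n) : Prop :=
  (forall i, S i i = 0) /\ (forall i j, i != j -> `|S i j| = 1).

(** The diagonals of the two off-diagonal blocks carry beta and its conjugate,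
    as S vanishes there; these entries are off the diagonal of the large
    matrix, which is why |beta| = 1 is required. *)
Lemma seidel_double (C : numClosedFieldType) (n : nat) (S : 'M[C]_n) (be : C) :
  seidel S -> `|be| = 1 ->
  seidel (block_mx S (S + be%:M) (S + (be^*)%:M) (- S)).
Proof.
move=> [S0 S1] be1; split=> [i | i j].
  case: (split_ordP i) => k ->; rewrite ?block_mxEul ?block_mxEdr ?mxE S0 //.
  by rewrite oppr0.
case: (split_ordP i) => k ->; case: (split_ordP j) => l ->.
- by rewrite block_mxEul (inj_eq (@lshift_inj _ _)); exact: S1.
- rewrite block_mxEur !mxE => _; have [->|nkl] := eqVneq k l.
    by rewrite S0 add0r.
  by rewrite addr0 S1.
- rewrite block_mxEdl !mxE => _; have [->|nkl] := eqVneq k l.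
    by rewrite S0 add0r norm_conjC.
  by rewrite addr0 S1.
- by rewrite block_mxEdr (inj_eq (@rshift_inj _ _)) mxE normrN; exact: S1.
Qed.

Local Open Scope complex_scope.

Section EtfGram.
Variables (R : realType) (d n : nat) (F : 'M[R[i]]_(d, n)).

Lemma etf_gram : etf F -> F^t* *m F = 1%:M + (welch R d n)%:C *: signature_mx F.
Proof.
case=> dn _ _ _; rewrite /signature_mx scalerA divff ?scale1r; last first.
  by rewrite fmorph_eq0 lt0r_neq0 ?welch_gt0.
by rewrite addrC subrK.
Qed.

Lemma etf_seidel : etf F -> seidel (signature_mx F).
Proof.
case=> dn Fnorm Fang _.
have entry (k : R[i]) (M : 'M_n) i j :
    (k *: (M - 1%:M)) i j = k * (M i j - (i == j)%:R) by rewrite !mxE.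
split=> [i | i j nij]; rewrite entry.
  by rewrite gram_diag eqxx -[X in X - _]sqrtCK Fnorm expr1n subrr mulr0.
rewrite (negPf nij) subr0 normrM Fang // normfV.
have w0 : 0 < (welch R d n)%:C by rewrite ltcR welch_gt0.
by rewrite gtr0_norm // mulVf ?lt0r_neq0.
Qed.

(** The converse of [etf_gram] and [etf_seidel] combined; frames are recognized
    as ETFs through their Gram matrix by this lemma. *)
Lemma etf_of_gram (S : 'M[R[i]]_n) : (0 < d < n)%N ->
  F^t* *m F = 1%:M + (welch R d n)%:C *: S -> seidel S ->
  F *m F^t* = (n%:R / d%:R)%:M ->
  etf F /\ signature_mx F = S.
Proof.
move=> dn FF [S0 S1] tF.
have w0 : 0 < (welch R d n)%:C by rewrite ltcR welch_gt0.
split; last first.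
  by rewrite /signature_mx FF addrC addKr scalerA mulVf ?scale1r ?lt0r_neq0.
split=> // [j | i j nij].
  by rewrite -gram_diag FF !mxE eqxx S0 mulr0 addr0 sqrtC1.
by rewrite FF !mxE (negPf nij) add0r normrM S1 // mulr1 gtr0_norm.
Qed.

End EtfGram.

(** Tightness of F says that the rows of sqrt(d/n) F are orthonormal.  If W
    completes them, then sqrt(n/(n - d)) W has Gram matrix
    n/(n - d) I - d/(n - d) F^*F = I - mu d/(n - d) S, and mu d/(n - d) = nu. *)
Lemma exists_naimark (R : realType) (d n : nat) (F : 'M[R[i]]_(d, n)) :
  etf F -> exists G : 'M[R[i]]_(n - d, n), naimark_complement F G.
Proof.
move=> eF; have [dn _ _ tF] := eF.
have cd := compl_dims dn.
have [d0 ltdn n1] := frame_dims_gt0 R[i] dn.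
have nd0 : 0 < n%:R - d%:R :> R[i] by rewrite subr_gt0.
have n0 : 0 < n%:R :> R[i] by apply: lt_trans n1.
have dn0 := lt0r_neq0 d0; have nn0 := lt0r_neq0 n0; have ndn0 := lt0r_neq0 nd0.
pose s : R[i] := sqrtC (d%:R / n%:R).
pose t : R[i] := sqrtC (n%:R / (n%:R - d%:R)).
have cs : Num.conj s = s by rewrite geC0_conj // sqrtC_ge0 divr_ge0 ?ltW.
have ct : Num.conj t = t by rewrite geC0_conj // sqrtC_ge0 divr_ge0 ?ltW.
have ss : s * s = d%:R / n%:R by rewrite -expr2 sqrtCK.
have tt : t * t = n%:R / (n%:R - d%:R) by rewrite -expr2 sqrtCK.
have uV : s *: F \is unitarymx.
  apply/unitarymxP; rewrite adjmxZ -scalemxAl -scalemxAr scalerA cs ss tF.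
  by rewrite scale_scalar_mx; congr (_%:M); field; rewrite dn0 nn0.
have [W uW VW] := orthonormal_complement uV.
have balC : (welch R d n)%:C * d%:R
    = (welch R (n - d) n)%:C * (n%:R - d%:R) :> R[i].
  have := congr1 (real_complex R) (welch_balance R dn).
  by rewrite !rmorphM rmorphB !rmorph_nat.
exists (t *: W).
have WW : W^t* *m W = 1%:M - (d%:R / n%:R) *: (F^t* *m F).
  rewrite -VW adjmxZ -scalemxAl -scalemxAr scalerA cs ss.
  by rewrite [X in X - _]addrC addrK.
have [S0 S1] := etf_seidel eF.
suff : etf (t *: W) /\ signature_mx (t *: W) = - signature_mx F by [].
apply: etf_of_gram => //.
- rewrite adjmxZ -scalemxAl -scalemxAr scalerA ct tt WW etf_gram //.
  move: (signature_mx F) => S.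
  have -> : (welch R (n - d) n)%:C = (welch R d n)%:C * d%:R / (n%:R - d%:R).
    by rewrite balC mulfK.
  apply/matrixP=> i j; rewrite !mxE.
  by field; rewrite nn0 ndn0.
- split=> [i|i j nij]; first by rewrite mxE S0 oppr0.
  by rewrite mxE normrN S1.
- rewrite adjmxZ -scalemxAl -scalemxAr scalerA ct tt (unitarymxP uW).
  by rewrite scalemx1 compl_natr.
Qed.

(** * The doubled frame is an ETF *)

Lemma gram_castmx (C : numClosedFieldType) (m m' n : nat) (e : m = m')
    (A : 'M[C]_(m, n)) :
  (castmx (e, erefl n) A)^t* *m castmx (e, erefl n) A = A^t* *m A.
Proof. by case: m' / e; rewrite castmx_id. Qed.

Lemma tight_castmx (C : numClosedFieldType) (m m' n : nat) (e : m = m')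
    (A : 'M[C]_(m, n)) (x : C) :
  A *m A^t* = x%:M ->
  castmx (e, erefl n) A *m (castmx (e, erefl n) A)^t* = x%:M.
Proof. by case: m' / e; rewrite castmx_id. Qed.

Section DoublingEtf.
Variables (R : realType) (d n : nat).
Hypothesis dn : (0 < d < n)%N.
Let mu := welch R d n.
Let nu := welch R (n - d) n.
Let lam := welch R n (n + n).
Let c := cparam R d n.

Lemma double_dims : (0 < n < n + n)%N.
Proof.
case/andP: dn => d0 ltdn; have n0 : (0 < n)%N := leq_ltn_trans (leq0n _) ltdn.
by rewrite n0 -[X in (X < _)%N]addn0 ltn_add2l.
Qed.

Lemma welch_double : lam = 1 / Num.sqrt (2 * n%:R - 1).
Proof.
have [d0 ltdn n1] := frame_dims_gt0 R dn.
have n0 : 0 < n%:R :> R by apply: lt_trans n1.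
have l0 : 0 < 2 * n%:R - 1 :> R by lra.
rewrite /lam /welch div1r -sqrtrV ?ltW //; congr Num.sqrt.
by rewrite natrD; field; apply/andP; split; rewrite lt0r_neq0 //; lra.
Qed.

Lemma welch_double_prod : lam ^+ 2 * (2 + mu * nu) = mu * nu.
Proof.
have [d0 ltdn n1] := frame_dims_gt0 R dn.
have n0 : 0 < n%:R :> R by apply: lt_trans n1.
have l0 : 0 < 2 * n%:R - 1 :> R by lra.
rewrite /lam sqr_welch ?double_dims //.
have -> : 2 + mu * nu = mu * nu * (2 * n%:R - 1).
  have : mu * nu * (n%:R - 1) = 1 := welch_prod R dn.
  by move: mu nu => x y; lra.
by rewrite natrD; field; apply/andP; split; rewrite lt0r_neq0 //; lra.
Qed.

(** Since lambda^2 = mu nu/(2 + mu nu), the claim is nu < mu (2 + mu nu).  The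
    bound c >= -1 reads nu <= mu + mu nu; it remains to see that
    nu < 1 + mu nu, which follows from that bound if mu < 1 and is clear
    if mu >= 1. *)
Lemma welch_double_lt : `|c| <= 1 -> lam < mu.
Proof.
have mu0 : 0 < mu := welch_gt0 R dn.
have nu0 : 0 < nu := welch_gt0 R (compl_dims dn).
have mn0 : 0 < mu * nu by rewrite mulr_gt0.
have lam0 : 0 < lam := welch_gt0 R double_dims.
rewrite /c cparamE // -/mu -/nu ler_norml => /andP[].
rewrite ler_pdivlMr // => cge _.
have nu_lt : nu < 1 + mu * nu.
  have [mu1|mu1] := ltP mu 1; first by lra.
  by apply: le_lt_trans (_ : mu * nu < _); [rewrite ler_peMl ?(ltW nu0) | lra].
rewrite -(ltr_pXn2r (_ : 0 < 2)%N) ?nnegrE ?ltW //.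
rewrite -(ltr_pM2r (_ : 0 < 2 + mu * nu)); last by lra.
rewrite welch_double_prod.
have step1 : 0 < mu ^+ 2 * (1 + mu * nu - nu).
  by rewrite mulr_gt0 ?exprn_gt0 // subr_gt0.
have step2 : 0 <= mu * (mu + mu * nu - nu).
  by rewrite mulr_ge0 ?(ltW mu0) //; lra.
lra.
Qed.

Lemma doubled_frame_etf (le_dn : (d <= n)%N) (F : 'M[R[i]]_(d, n))
    (G : 'M[R[i]]_(n - d, n)) (a b : R) (be w z : R[i]) :
  etf F -> naimark_complement F G ->
  `|c| <= 1 -> `|be| = 1 -> complex.Re be = - c ->
  a = Num.sqrt ((nu + lam) / (mu + nu)) ->
  b = Num.sqrt ((mu - lam) / (mu + nu)) ->
  w = lam%:C * (n%:R - d%:R + mu%:C * be * d%:R) / (a%:C * mu%:C * n%:R) ->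
  z = - lam%:C * (d%:R - nu%:C * be * (n%:R - d%:R)) / (b%:C * nu%:C * n%:R) ->
  let Phi := doubled_frame le_dn F G a b w z in
  [/\ 0 < a, 0 < b, etf Phi
    & signature_mx Phi = doubled_signature (signature_mx F) be].
Proof.
move=> eF [eG sG] c1 be1 beRe aE bE wE zE Phi.
have mu0 : 0 < mu := welch_gt0 R dn.
have nu0 : 0 < nu := welch_gt0 R (compl_dims dn).
have lam0 : 0 < lam := welch_gt0 R double_dims.
have mn0 : 0 < mu + nu by rewrite addr_gt0.
have aq0 : 0 < (nu + lam) / (mu + nu) by rewrite divr_gt0 ?addr_gt0.
have bq0 : 0 < (mu - lam) / (mu + nu).
  by rewrite divr_gt0 // subr_gt0 welch_double_lt.
have a0 : 0 < a by rewrite aE sqrtr_gt0.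
have b0 : 0 < b by rewrite bE sqrtr_gt0.
have {}aE : a ^+ 2 * (mu + nu) = nu + lam.
  by rewrite aE sqr_sqrtr ?ltW // divfK ?lt0r_neq0.
have {}bE : b ^+ 2 * (mu + nu) = mu - lam.
  by rewrite bE sqr_sqrtr ?ltW // divfK ?lt0r_neq0.
have [d0 ltdn n1] := frame_dims_gt0 R[i] dn.
have n0 : 0 < n%:R :> R[i] by apply: lt_trans n1.
have nd0 : 0 < n%:R - d%:R :> R[i] by rewrite subr_gt0.
have toC (x y : R) : x = y -> x%:C = y%:C by move->.
have mu0C : 0 < mu%:C by rewrite ltcR.
have nu0C : 0 < nu%:C by rewrite ltcR.
have lam0C : 0 < lam%:C by rewrite ltcR.
have a0C : 0 < a%:C by rewrite ltcR.
have b0C : 0 < b%:C by rewrite ltcR.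
have mnC : mu%:C + nu%:C != 0 by rewrite lt0r_neq0 ?addr_gt0.
have dE : d%:R = nu%:C * n%:R / (mu%:C + nu%:C).
  have := toC _ _ (welch_sum R dn); rewrite !rmorphM rmorphD !rmorph_nat => <-.
  by rewrite mulrC mulKf.
have ndE : n%:R - d%:R = mu%:C * n%:R / (mu%:C + nu%:C).
  have := toC _ _ (welch_sum_compl R dn).
  rewrite !rmorphM rmorphD rmorphB !rmorph_nat => <-.
  by rewrite mulrC mulKf.
have nn0 := lt0r_neq0 n0.
have mun0 := lt0r_neq0 mu0C; have nun0 := lt0r_neq0 nu0C.
have an0 := lt0r_neq0 a0C; have bn0 := lt0r_neq0 b0C.
have {}wE : w = lam%:C * (1 + nu%:C * be) / ((mu%:C + nu%:C) * a%:C).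
  by rewrite wE ndE dE; field; rewrite nn0 mun0 an0 mnC.
have {}zE : z = - lam%:C * (1 - mu%:C * be) / ((mu%:C + nu%:C) * b%:C).
  by rewrite zE ndE dE; field; rewrite nn0 nun0 bn0 mnC.
have lamE : lam%:C ^+ 2 * (2 + mu%:C * nu%:C) = mu%:C * nu%:C.
  have := toC _ _ welch_double_prod.
  by rewrite rmorphM rmorphXn rmorphD rmorph_nat !(rmorphM _ mu).
have {}aE : a%:C ^+ 2 * (mu%:C + nu%:C) = nu%:C + lam%:C.
  by have := toC _ _ aE; rewrite rmorphM rmorphXn !rmorphD.
have {}bE : b%:C ^+ 2 * (mu%:C + nu%:C) = mu%:C - lam%:C.
  by have := toC _ _ bE; rewrite rmorphM rmorphXn rmorphD rmorphB.
have be_norm : be * (Num.conj be) = 1 by rewrite -normCK be1 expr1n.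
have be_trace : (be + Num.conj be) * (mu%:C * nu%:C) = - 2 * (mu%:C - nu%:C).
  rewrite [X in X * _]addcJ beRe /c cparamE // -/mu -/nu.
  by rewrite !(rmorphN, rmorphM, fmorphV, rmorphB) /=; field; rewrite mun0 nun0.
have gF := etf_gram eF; have gG := etf_gram eG.
rewrite sG scalerN -/mu -/nu in gF gG.
have [_ _ _ tF] := eF; have [_ _ _ tG] := eG.
suff [] : etf Phi /\ signature_mx Phi = doubled_signature (signature_mx F) be.
  by [].
apply: etf_of_gram; first exact: double_dims.
- rewrite gram_castmx wE zE.
  exact: (doubled_gram mu0C nu0C lam0C a0C b0C lamE aE bE be_norm be_trace
            gF gG).
- exact: seidel_double (etf_seidel eF) be1.
- apply: tight_castmx; rewrite wE zE.
  have -> : (n + n)%:R / n%:R = 2 :> R[i] by rewrite natrD; field.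
  apply: (doubled_tight mu0C nu0C lam0C a0C b0C lamE aE bE be_norm be_trace
            gF gG tF tG).
    by rewrite dE; field; rewrite nn0 nun0 mnC.
  by rewrite compl_natr // ndE; field; rewrite nn0 mun0 mnC.
Qed.

Lemma doubled_etf_signature (F : 'M[R[i]]_(d, n)) (be : R[i]) :
  etf F -> `|c| <= 1 -> `|be| = 1 -> complex.Re be = - c ->
  etf_signature n (doubled_signature (signature_mx F) be).
Proof.
move=> eF c1 be1 beRe; have [G nFG] := exists_naimark eF.
have [_ /ltnW le_dn] := andP dn.
have [_ _ ePhi sPhi] := doubled_frame_etf le_dn eF nFG c1 be1 beRe
  erefl erefl erefl erefl.
by eexists; [exact: ePhi | rewrite sPhi].
Qed.

End DoublingEtf.

Lemma unimodular_of_Re (R : rcfType) (eps c : R) :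
  eps = 1 \/ eps = -1 -> `|c| <= 1 ->
  `|(- c) +i* (eps * Num.sqrt (1 - c ^+ 2))| = 1.
Proof.
move=> eps1 c1.
have c2 : 0 <= 1 - c ^+ 2.
  by rewrite subr_ge0 -real_normK ?num_real // expr_le1.
rewrite normc_def /= exprMn sqr_sqrtr //.
have -> : eps ^+ 2 = 1 by case: eps1 => ->; rewrite ?sqrrN expr1n.
by rewrite mul1r sqrrN addrC subrK sqrtr1.
Qed.

Theorem theorem6 (R : realType) (n d : nat) (d_ge1 : (1 <= d)%N)
    (lt_dn : (d < n)%N) :
  let c : R := cparam R d n in
  `|c| <= 1 ->
  ((exists F : 'M[R[i]]_(d, n), etf F) ->
   exists Phi : 'M[R[i]]_(n, n + n), etf Phi)
  /\
  (forall eps : R, eps = 1 \/ eps = -1 ->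
   let beta : R[i] := (- c) +i* (eps * Num.sqrt (1 - c ^+ 2)) in
   (forall S : 'M[R[i]]_n,
      etf_signature d S -> etf_signature n (doubled_signature S beta))
   /\
   (forall (F : 'M[R[i]]_(d, n)) (G : 'M[R[i]]_(n - d, n)),
      etf F -> naimark_complement F G ->
      let mu : R := Num.sqrt ((n%:R - d%:R) / (d%:R * (n%:R - 1))) in
      let nu : R := Num.sqrt (d%:R / ((n%:R - d%:R) * (n%:R - 1))) in
      let lambda : R := 1 / Num.sqrt (2 * n%:R - 1) in
      exists (a b : R) (w z : R[i]),
        let Phi := doubled_frame (ltnW lt_dn) F G a b w z in
        [/\ 0 < a, 0 < b & etf Phi]
        /\
        [/\ a = Num.sqrt ((nu + lambda) / (mu + nu)),
            b = Num.sqrt ((mu - lambda) / (mu + nu)),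
            w = lambda%:C * (n%:R - d%:R + mu%:C * beta * d%:R)
                / (a%:C * mu%:C * n%:R)
          & z = - lambda%:C * (d%:R - nu%:C * beta * (n%:R - d%:R))
                / (b%:C * nu%:C * n%:R)]
        /\
        signature_mx Phi = doubled_signature (signature_mx F) beta)).
Proof.
move=> c c1; have dn : (0 < d < n)%N by rewrite d_ge1.
have part_a (eps : R) (F : 'M[R[i]]_(d, n)) :
    eps = 1 \/ eps = -1 -> etf F ->
    etf_signature n (doubled_signature (signature_mx F)
                       ((- c) +i* (eps * Num.sqrt (1 - c ^+ 2)))).
  move=> eps1 eF.
  exact: (doubled_etf_signature dn eF c1 (unimodular_of_Re eps1 c1)).
split=> [[F eF] | eps eps1 beta].
  by have [Phi ePhi _] := part_a 1 F (or_introl erefl) eF; exists Phi.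
split=> [S [F eF ->] | F G eF nFG mu nu lambda]; first exact: part_a.
have -> : nu = welch R (n - d) n by rewrite welch_compl.
have -> : lambda = welch R n (n + n) by rewrite (welch_double R dn).
have beta1 : `|beta| = 1 by exact: unimodular_of_Re.
have [a0 b0 ePhi sPhi] := doubled_frame_etf dn (ltnW lt_dn) eF nFG c1 beta1
  erefl erefl erefl erefl erefl.
by do 4![eexists]; split; [split; [exact: a0 | exact: b0 | exact: ePhi] | ].
Qed.
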